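(* Let $q\in(0,1)$ and $k>0$. Let $a,b,c,d,\alpha,\beta$ be positive real numbers such that $\beta d\leq \alpha b$ and such that, for every $t\in[0,\infty)$, $a+bt\leq c+dt$, $\psi_{q,k}(a+bt)>0$ and $\psi_{q,k}(c+dt)>0$. Define $$G(t)=\frac{[\psi_{q,k}(a+bt)]^{\alpha}}{[\psi_{q,k}(c+dt)]^{\beta}},\qquad t\in[0,\infty).$$ Then $G$ is nondecreasing on $[0,\infty)$, and for every $t\in[0,1]$ the inequalities $$\frac{[\psi_{q,k}(a)]^{\alpha}}{[\psi_{q,k}(c)]^{\beta}}\leq \frac{[\psi_{q,k}(a+bt)]^{\alpha}}{[\psi_{q,k}(c+dt)]^{\beta}}\leq \frac{[\psi_{q,k}(a+b)]^{\alpha}}{[\psi_{q,k}(c+d)]^{\beta}}$$ hold.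
   Context: For $q\in(0,1)$, real $k>0$ and $t>0$, write $(1-q^{t})_{q,k}^{\infty}=\prod_{j=0}^{\infty}(1-q^{t+jk})$. The $(q,k)$-Gamma function is $$\Gamma_{q,k}(t)=\frac{(1-q^{k})_{q,k}^{\infty}}{(1-q^{t})_{q,k}^{\infty}\,(1-q)^{\frac{t}{k}-1}},\qquad t>0,$$ and the $(q,k)$-digamma function is $\psi_{q,k}(t)=\frac{d}{dt}\ln\Gamma_{q,k}(t)=\Gamma_{q,k}'(t)/\Gamma_{q,k}(t)$ for $t>0$. *)

(* Defs.v *)
From Stdlib Require Export Reals.
From Coquelicot Require Export Coquelicot.
Open Scope R_scope.

(* The infinite product (1 - q^t)_{q,k}^oo, as the limit of the partial
   products over 0 <= j <= n.  [Lim_seq] and [Derive] below are total; only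
   0 < q < 1, 0 < k and 0 < t is meaningful. *)
Definition qk_prod (q k t : R) : R :=
  real (Lim_seq (fun n : nat =>
    prod_f_R0 (fun j : nat => 1 - Rpower q (t + INR j * k)) n)).

Definition qk_Gamma (q k t : R) : R :=
  qk_prod q k k / (qk_prod q k t * Rpower (1 - q) (t / k - 1)).

Definition qk_digamma (q k t : R) : R :=
  Derive (fun x : R => ln (qk_Gamma q k x)) t.

(* Main.v *)
Require Import Defs.
From Stdlib Require Import Reals Lra.
From Coquelicot Require Import Coquelicot.
Open Scope R_scope.

(** The digamma function is positive where it matters, increasing and concave,
    and these properties alone give the monotonicity of [G].  Indeed
    [L = ln o psi] is then increasing and concave.  On a time interval [[s, t]]
    the arguments [a + b t] and [c + d t] sweep two intervals, the first of
    which has both ends to the left of those of the second; so the chord slope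
    of [L] over the first is at least its slope over the second, and both are
    nonnegative.  Multiplying by [alpha b >= beta d] gives that
    [ln G = alpha L(a + b t) - beta L(c + d t)] increases
    ([concave_on_chords], [concave_on_ln]).

    Concavity of [psi] comes from the expansion
    [psi(x) = - ln (1 - q) / k + ln q * sum_j u_j / (1 - u_j)] with
    [u_j = q^(x + j k)]: each [u / (1 - u)] is convex in [x], being a convex
    increasing function of [u = q^x], and [ln q < 0].

    The expansion itself must be justified by differentiating [ln Gamma_{q,k}]
    term by term.  Convexity replaces uniform convergence here.  Each term
    [- ln (1 - q^(x + j k))] is convex and lies above its tangents; summing,
    the series of derivatives is a subgradient of [ln Gamma_{q,k}]
    ([subgradient_ln_qk_Gamma]).  That series is concave
    ([concave_qk_digamma_series]), hence locally Lipschitz, and a continuous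
    subgradient is the derivative ([is_derive_concave_subgradient]).  The same
    subgradient property shows that [psi] is increasing. *)

(** * Concave functions *)

(** The weights are left unnormalised: this form is linear in [f] and has no
    quotient, so it passes directly to sums of series. *)
Definition concave_on (D : R -> Prop) (f : R -> R) : Prop :=
  forall x y z, D x -> D y -> D z -> x <= y -> y <= z ->
    (z - y) * f x + (y - x) * f z <= (z - x) * f y.

(** Chord slopes decrease when both ends move to the right: move first the
    right end from [y] to [y'], then the left end from [x] to [x']. *)
Lemma concave_on_chords (D : R -> Prop) (f : R -> R) (x y x' y' : R) :
  concave_on D f -> D x -> D y -> D x' -> D y' ->
  x < y -> x' < y' -> x <= x' -> y <= y' ->
  (y - x) * (f y' - f x') <= (y' - x') * (f y - f x).
Proof.
  intros Hf Dx Dy Dx' Dy' Hxy Hxy' Hx Hy.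
  pose proof (Hf x y y' Dx Dy Dy' ltac:(lra) Hy) as H1.
  pose proof (Hf x x' y' Dx Dx' Dy' Hx ltac:(lra)) as H2.
  apply Rmult_le_reg_l with (y' - x); [lra|].
  apply Rle_trans with ((y - x) * ((y' - x') * (f y' - f x))).
  - replace ((y' - x) * ((y - x) * (f y' - f x')))
      with ((y - x) * ((y' - x) * (f y' - f x'))) by ring.
    apply Rmult_le_compat_l; lra.
  - replace ((y - x) * ((y' - x') * (f y' - f x)))
      with ((y' - x') * ((y - x) * (f y' - f x))) by ring.
    replace ((y' - x) * ((y' - x') * (f y - f x)))
      with ((y' - x') * ((y' - x) * (f y - f x))) by ring.
    apply Rmult_le_compat_l; lra.
Qed.

Lemma ln_le_sub_1 (x : R) : 0 < x -> ln x <= x - 1.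
Proof.
  intros Hx. pose proof (exp_ineq1_le (ln x)) as H.
  rewrite exp_ln in H; lra.
Qed.

Lemma ln_le_tangent (m x : R) : 0 < m -> 0 < x -> ln x <= ln m + (x - m) / m.
Proof.
  intros Hm Hx.
  pose proof (ln_le_sub_1 (x / m) (Rdiv_lt_0_compat _ _ Hx Hm)) as H.
  rewrite ln_div in H by assumption.
  replace ((x - m) / m) with (x / m - 1) by (field; lra). lra.
Qed.

(** The tangent to [ln] at [f y] bounds [ln (f x)] and [ln (f z)] by affine
    functions of [f x] and [f z], to which the concavity of [f] applies. *)
Lemma concave_on_ln (D : R -> Prop) (f : R -> R) :
  concave_on D f -> concave_on (fun x => D x /\ 0 < f x) (fun x => ln (f x)).
Proof.
  intros Hf x y z [Dx Px] [Dy Py] [Dz Pz] Hxy Hyz.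
  pose proof (Hf x y z Dx Dy Dz Hxy Hyz) as H.
  pose proof (ln_le_tangent (f y) (f x) Py Px) as Hx.
  pose proof (ln_le_tangent (f y) (f z) Py Pz) as Hz.
  apply Rmult_le_compat_l with (r := z - y) in Hx; [|lra].
  apply Rmult_le_compat_l with (r := y - x) in Hz; [|lra].
  assert (((z - y) * f x + (y - x) * f z - (z - x) * f y) / f y <= 0) as Hd.
  { apply Rmult_le_reg_r with (f y); [exact Py|].
    unfold Rdiv. rewrite Rmult_assoc, Rinv_l by lra. lra. }
  replace (((z - y) * f x + (y - x) * f z - (z - x) * f y) / f y)
    with ((z - y) * ((f x - f y) / f y) + (y - x) * ((f z - f y) / f y)) in Hd
    by (field; lra).
  lra.
Qed.

(** * Subgradients *)

Definition subgradient_on (D : R -> Prop) (f g : R -> R) : Prop :=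
  forall x y, D x -> D y -> f x + g x * (y - x) <= f y.

(** Add the inequalities for the pairs [(x, y)] and [(y, x)]. *)
Lemma subgradient_on_increasing (D : R -> Prop) (f g : R -> R) (x y : R) :
  subgradient_on D f g -> D x -> D y -> x <= y -> g x <= g y.
Proof.
  intros Hfg Dx Dy [Hxy | <-]; [|lra].
  pose proof (Hfg x y Dx Dy). pose proof (Hfg y x Dy Dx).
  apply Rmult_le_reg_r with (y - x); lra.
Qed.

(** The two subgradient inequalities place the difference quotient
    between [g x] and [g (x + h)].  To the right of [x / 2] the chords of [g]
    are no steeper than the chord over [[x / 4, x / 2]], so [g (x + h)] is
    within [K * |h|] of [g x], where [K] is the slope of that chord. *)
Lemma is_derive_concave_subgradient (f g : R -> R) (x : R) :
  subgradient_on (Rlt 0) f g -> concave_on (Rlt 0) g -> 0 < x ->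
  is_derive f x (g x).
Proof.
  intros Hfg Hg Hx.
  apply is_derive_Reals. intros eps Heps.
  set (K := (g (x / 2) - g (x / 4)) / (x / 4)).
  assert (HK : 0 <= K).
  { pose proof (subgradient_on_increasing _ f g (x / 4) (x / 2) Hfg
      ltac:(lra) ltac:(lra) ltac:(lra)).
    apply Rmult_le_pos; [lra|]. apply Rlt_le, Rinv_0_lt_compat; lra. }
  assert (HKx : g (x / 2) - g (x / 4) = K * (x / 4)) by (unfold K; field; lra).
  assert (Hlip : forall u v, x / 2 < u -> u < v -> g v - g u <= K * (v - u)).
  { intros u v Hu Huv.
    pose proof (concave_on_chords _ g (x / 4) (x / 2) u v Hg
      ltac:(lra) ltac:(lra) ltac:(lra) ltac:(lra)
      ltac:(lra) Huv ltac:(lra) ltac:(lra)) as H.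
    rewrite HKx in H. apply Rmult_le_reg_l with (x / 4); lra. }
  assert (Hd : 0 < Rmin (x / 2) (eps / (K + 1))).
  { apply Rmin_pos; [lra|]. apply Rdiv_lt_0_compat; lra. }
  exists (mkposreal _ Hd). simpl. intros h Hh0 Hh.
  assert (Hh1 := Rlt_le_trans _ _ _ Hh (Rmin_l _ _)).
  assert (Hh2 := Rlt_le_trans _ _ _ Hh (Rmin_r _ _)).
  assert (HKh : K * Rabs h < eps).
  { apply Rmult_lt_compat_r with (r := K + 1) in Hh2; [|lra].
    unfold Rdiv in Hh2. rewrite Rmult_assoc, Rinv_l in Hh2 by lra.
    pose proof (Rabs_pos h). lra. }
  apply Rabs_def2 in Hh1. destruct Hh1 as [Hh1 Hh3].
  pose proof (Hfg x (x + h) ltac:(lra) ltac:(lra)) as Hlo.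
  pose proof (Hfg (x + h) x ltac:(lra) ltac:(lra)) as Hup.
  set (Q := (f (x + h) - f x) / h).
  assert (HQ : f (x + h) - f x = Q * h) by (unfold Q; field; exact Hh0).
  destruct (Rdichotomy _ _ Hh0) as [Hn | Hp].
  - rewrite Rabs_left in HKh by exact Hn.
    pose proof (Hlip (x + h) x ltac:(lra) ltac:(lra)) as HL.
    assert (Q <= g x) by (apply Rmult_le_reg_r with (- h); lra).
    assert (g (x + h) <= Q) by (apply Rmult_le_reg_r with (- h); lra).
    apply Rabs_def1; lra.
  - rewrite Rabs_right in HKh by lra.
    pose proof (Hlip x (x + h) ltac:(lra) ltac:(lra)) as HL.
    assert (g x <= Q) by (apply Rmult_le_reg_r with h; lra).
    assert (Q <= g (x + h)) by (apply Rmult_le_reg_r with h; lra).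
    apply Rabs_def1; lra.
Qed.

(** * Tangent inequalities for the terms of the series *)

Lemma Rpower_bounds (q x : R) : 0 < q < 1 -> 0 < x -> 0 < Rpower q x < 1.
Proof.
  intros Hq Hx. split; [apply exp_pos|].
  rewrite <- (Rpower_O q) by lra. unfold Rpower.
  apply exp_increasing.
  assert (ln q < 0) by (rewrite <- ln_1; apply ln_increasing; lra).
  nra.
Qed.

Lemma Rpower_ge_tangent (q x y : R) :
  Rpower q x * (1 + ln q * (y - x)) <= Rpower q y.
Proof.
  unfold Rpower. replace (y * ln q) with (x * ln q + ln q * (y - x)) by ring.
  rewrite exp_plus. apply Rmult_le_compat_l; [apply Rlt_le, exp_pos|].
  apply exp_ineq1_le.
Qed.

(** [- ln q * qterm q x] is the derivative of [ln (1 - q^x)]. *)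
Definition qterm (q x : R) : R := Rpower q x / (1 - Rpower q x).

(** Convexity of [qterm q] through its tangents: the tangent inequality for
    [u / (1 - u)] in [u], whose slope is positive, is composed with the one for
    [u = q^x] in [x]. *)
Lemma qterm_ge_tangent (q x y : R) : 0 < q < 1 -> 0 < x -> 0 < y ->
  qterm q x + ln q * Rpower q x / (1 - Rpower q x) ^ 2 * (y - x) <= qterm q y.
Proof.
  intros Hq Hx Hy.
  pose proof (Rpower_bounds q x Hq Hx) as Hu.
  pose proof (Rpower_bounds q y Hq Hy) as Hv.
  pose proof (Rpower_ge_tangent q x y) as Ht.
  unfold qterm.
  set (u := Rpower q x) in *. set (v := Rpower q y) in *.
  apply Rle_trans with (u / (1 - u) + (v - u) / (1 - u) ^ 2).
  - replace (ln q * u / (1 - u) ^ 2 * (y - x))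
      with ((ln q * u * (y - x)) / (1 - u) ^ 2) by (field; lra).
    apply Rplus_le_compat_l, Rmult_le_compat_r; [|lra].
    apply Rlt_le, Rinv_0_lt_compat, pow_lt; lra.
  - apply Rminus_le_0.
    (* The error of the tangent to [u / (1 - u)] is an explicit square. *)
    replace (v / (1 - v) - (u / (1 - u) + (v - u) / (1 - u) ^ 2))
      with ((v - u) ^ 2 * / ((1 - v) * (1 - u) ^ 2)) by (field; lra).
    apply Rmult_le_pos; [apply pow2_ge_0|].
    apply Rlt_le, Rinv_0_lt_compat, Rmult_lt_0_compat; [lra|].
    apply pow_lt; lra.
Qed.

(** The two tangent inequalities at the middle point [y], weighted so that the
    slopes cancel. *)
Lemma qterm_convex (q x y z : R) : 0 < q < 1 -> 0 < x -> x <= y -> y <= z ->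
  0 <= (z - y) * qterm q x + (y - x) * qterm q z - (z - x) * qterm q y.
Proof.
  intros Hq Hx Hxy Hyz.
  pose proof (qterm_ge_tangent q y x Hq ltac:(lra) Hx) as H1.
  pose proof (qterm_ge_tangent q y z Hq ltac:(lra) ltac:(lra)) as H2.
  apply Rmult_le_compat_l with (r := z - y) in H1; [|lra].
  apply Rmult_le_compat_l with (r := y - x) in H2; [|lra].
  lra.
Qed.

(** The concave function [ln (1 - q^x)] lies below its tangents; again this
    composes the tangent inequalities of [ln] and of [q^x]. *)
Lemma ln_one_minus_qpow_le (q x y : R) : 0 < q < 1 -> 0 < x -> 0 < y ->
  ln (1 - Rpower q y) <= ln (1 - Rpower q x) - ln q * qterm q x * (y - x).
Proof.
  intros Hq Hx Hy.
  pose proof (Rpower_bounds q x Hq Hx) as Hu.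
  pose proof (Rpower_bounds q y Hq Hy) as Hv.
  pose proof (Rpower_ge_tangent q x y) as Ht.
  pose proof (ln_le_tangent (1 - Rpower q x) (1 - Rpower q y)
    ltac:(lra) ltac:(lra)) as Hl.
  unfold qterm.
  set (u := Rpower q x) in *. set (v := Rpower q y) in *.
  replace (ln (1 - u) - ln q * (u / (1 - u)) * (y - x))
    with (ln (1 - u) + (- (ln q * u * (y - x))) / (1 - u)) by (field; lra).
  eapply Rle_trans; [exact Hl|].
  apply Rplus_le_compat_l, Rmult_le_compat_r; [|lra].
  apply Rlt_le, Rinv_0_lt_compat; lra.
Qed.

(** * Convergence of the series *)

Lemma is_series_nonneg (u : nat -> R) (l : R) :
  (forall n, 0 <= u n) -> is_series u l -> 0 <= l.
Proof.
  intros Hu Hl. rewrite <- (is_series_unique _ _ Hl).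
  rewrite <- (Rmult_0_l (Series u)), <- Series_scal_l.
  apply Series_le; [|now exists l].
  intros n. specialize (Hu n). split; lra.
Qed.

Lemma shift_pos (k x : R) (j : nat) : 0 < k -> 0 < x -> 0 < x + INR j * k.
Proof. intros Hk Hx. pose proof (pos_INR j). nra. Qed.

Lemma qterm_nonneg (q x : R) : 0 < q < 1 -> 0 < x -> 0 <= qterm q x.
Proof.
  intros Hq Hx. pose proof (Rpower_bounds q x Hq Hx).
  apply Rlt_le, Rdiv_lt_0_compat; lra.
Qed.

(** Comparison with the geometric series of ratio [q^k]: the denominators
    [1 - q^(x + j k)] are bounded below by [1 - q^x]. *)
Lemma ex_series_qterm (q k x : R) : 0 < q < 1 -> 0 < k -> 0 < x ->
  ex_series (fun j => qterm q (x + INR j * k)).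
Proof.
  intros Hq Hk Hx.
  pose proof (Rpower_bounds q x Hq Hx) as Hu.
  pose proof (Rpower_bounds q k Hq Hk) as Hr.
  apply (ex_series_le (V := R_CompleteNormedModule) _
    (fun j => (Rpower q x / (1 - Rpower q x)) * Rpower q k ^ j)).
  - intros j. pose proof (shift_pos k x j Hk Hx) as Hj.
    change (Rabs (qterm q (x + INR j * k))
      <= Rpower q x / (1 - Rpower q x) * Rpower q k ^ j).
    rewrite Rabs_pos_eq by now apply qterm_nonneg.
    unfold qterm.
    replace (Rpower q (x + INR j * k)) with (Rpower q x * Rpower q k ^ j).
    2:{ rewrite Rpower_plus, (Rmult_comm (INR j)), <- Rpower_mult.
        now rewrite Rpower_pow by lra. }
    assert (Hp : 0 < Rpower q k ^ j <= 1).
    { split; [apply pow_lt; lra|]. rewrite <- (pow1 j). apply pow_incr; lra. }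
    set (u := Rpower q x) in *. set (r := Rpower q k ^ j) in *.
    replace (u / (1 - u) * r) with (u * r * / (1 - u)) by (field; lra).
    apply Rmult_le_compat_l; [nra|].
    apply Rinv_le_contravar; nra.
  - apply (ex_series_scal_l (K := R_AbsRing) (V := R_NormedModule)
      (Rpower q x / (1 - Rpower q x)) (pow (Rpower q k))).
    apply ex_series_geom. rewrite Rabs_pos_eq; lra.
Qed.

(** For [0 < u < 1], [- ln (1 - u) = ln (1 / (1 - u)) <= u / (1 - u)]. *)
Lemma ex_series_ln_factor (q k x : R) : 0 < q < 1 -> 0 < k -> 0 < x ->
  ex_series (fun j => ln (1 - Rpower q (x + INR j * k))).
Proof.
  intros Hq Hk Hx.
  apply (ex_series_le (V := R_CompleteNormedModule) _
    (fun j => qterm q (x + INR j * k))); [|now apply ex_series_qterm].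
  intros j. pose proof (shift_pos k x j Hk Hx) as Hj.
  change (Rabs (ln (1 - Rpower q (x + INR j * k))) <= qterm q (x + INR j * k)).
  pose proof (Rpower_bounds q _ Hq Hj) as Hu.
  unfold qterm. set (u := Rpower q (x + INR j * k)) in *.
  pose proof (ln_le_sub_1 (1 - u) ltac:(lra)).
  rewrite Rabs_left1 by lra.
  pose proof (ln_le_tangent (1 - u) 1 ltac:(lra) ltac:(lra)) as H1.
  rewrite ln_1 in H1. replace (1 - (1 - u)) with u in H1 by ring. lra.
Qed.

(** Besides giving the logarithm of the product, this shows that the infinite
    product does not vanish. *)
Lemma qk_prod_eq_exp (q k x : R) : 0 < q < 1 -> 0 < k -> 0 < x ->
  qk_prod q k x = exp (Series (fun j => ln (1 - Rpower q (x + INR j * k)))).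
Proof.
  intros Hq Hk Hx. unfold qk_prod.
  set (u := fun j => ln (1 - Rpower q (x + INR j * k))).
  assert (Hprod : forall n,
    exp (sum_n u n)
    = prod_f_R0 (fun j => 1 - Rpower q (x + INR j * k)) n).
  { assert (Hf : forall j, exp (u j) = 1 - Rpower q (x + INR j * k)).
    { intros j. apply exp_ln.
      pose proof (Rpower_bounds q _ Hq (shift_pos k x j Hk Hx)). lra. }
    induction n as [|n IH].
    - rewrite sum_O. apply Hf.
    - rewrite sum_Sn. change (plus (sum_n u n) (u (S n)))
        with (sum_n u n + u (S n)).
      now rewrite exp_plus, IH, Hf. }
  assert (Hlim : is_lim_seq
    (fun n => prod_f_R0 (fun j => 1 - Rpower q (x + INR j * k)) n)
    (exp (Series u))).
  { apply (is_lim_seq_ext _ _ _ Hprod).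
    apply (is_lim_seq_continuous exp (sum_n u) (Series u)).
    - apply derivable_continuous_pt, derivable_pt_exp.
    - exact (Series_correct _ (ex_series_ln_factor q k x Hq Hk Hx)). }
  now rewrite (is_lim_seq_unique _ _ Hlim).
Qed.

(** * The digamma function *)

Definition qk_digamma_series (q k x : R) : R :=
  - ln (1 - q) / k + ln q * Series (fun j => qterm q (x + INR j * k)).

Lemma ln_qk_Gamma (q k x : R) : 0 < q < 1 -> 0 < k -> 0 < x ->
  ln (qk_Gamma q k x)
  = Series (fun j => ln (1 - Rpower q (k + INR j * k)))
    - Series (fun j => ln (1 - Rpower q (x + INR j * k)))
    - (x / k - 1) * ln (1 - q).
Proof.
  intros Hq Hk Hx. unfold qk_Gamma.
  rewrite !qk_prod_eq_exp by assumption. unfold Rpower at 3.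
  rewrite <- exp_plus, ln_div, !ln_exp by apply exp_pos. ring.
Qed.

Lemma subgradient_ln_qk_Gamma (q k : R) : 0 < q < 1 -> 0 < k ->
  subgradient_on (Rlt 0)
    (fun x => ln (qk_Gamma q k x)) (qk_digamma_series q k).
Proof.
  intros Hq Hk x y Hx Hy.
  rewrite !ln_qk_Gamma by assumption. unfold qk_digamma_series.
  pose proof (Series_correct _ (ex_series_ln_factor q k x Hq Hk Hx)) as Sx.
  pose proof (Series_correct _ (ex_series_ln_factor q k y Hq Hk Hy)) as Sy.
  pose proof (Series_correct _ (ex_series_qterm q k x Hq Hk Hx)) as Tx.
  pose proof (is_series_minus _ _ _ _ (is_series_minus _ _ _ _ Sx Sy)
    (is_series_scal (ln q * (y - x)) _ _ Tx)) as HS.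
  apply is_series_nonneg in HS.
  - change (0 <= Series (fun j => ln (1 - Rpower q (x + INR j * k)))
      - Series (fun j => ln (1 - Rpower q (y + INR j * k)))
      - ln q * (y - x) * Series (fun j => qterm q (x + INR j * k))) in HS.
    apply Rminus_le_0.
    match type of HS with 0 <= ?e => match goal with |- 0 <= ?e' =>
      replace e' with e by (field; lra) end end.
    exact HS.
  - intros j.
    change (0 <= ln (1 - Rpower q (x + INR j * k))
      - ln (1 - Rpower q (y + INR j * k))
      - ln q * (y - x) * qterm q (x + INR j * k)).
    pose proof (ln_one_minus_qpow_le q (x + INR j * k) (y + INR j * k) Hq
      (shift_pos k x j Hk Hx) (shift_pos k y j Hk Hy)) as H.
    replace (y + INR j * k - (x + INR j * k)) with (y - x) in H by ring.
    lra.
Qed.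

Lemma concave_qk_digamma_series (q k : R) : 0 < q < 1 -> 0 < k ->
  concave_on (Rlt 0) (qk_digamma_series q k).
Proof.
  intros Hq Hk x y z Hx Hy Hz Hxy Hyz. unfold qk_digamma_series.
  assert (Hlq : ln q < 0) by (rewrite <- ln_1; apply ln_increasing; lra).
  pose proof (Series_correct _ (ex_series_qterm q k x Hq Hk Hx)) as Tx.
  pose proof (Series_correct _ (ex_series_qterm q k y Hq Hk Hy)) as Ty.
  pose proof (Series_correct _ (ex_series_qterm q k z Hq Hk Hz)) as Tz.
  pose proof (is_series_minus _ _ _ _
    (is_series_plus _ _ _ _ (is_series_scal (z - y) _ _ Tx)
      (is_series_scal (y - x) _ _ Tz))
    (is_series_scal (z - x) _ _ Ty)) as HS.
  apply is_series_nonneg in HS.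
  - change (0 <= (z - y) * Series (fun j => qterm q (x + INR j * k))
      + (y - x) * Series (fun j => qterm q (z + INR j * k))
      - (z - x) * Series (fun j => qterm q (y + INR j * k))) in HS.
    apply Rmult_le_compat_l with (r := - ln q) in HS; [|lra].
    lra.
  - intros j.
    change (0 <= (z - y) * qterm q (x + INR j * k)
      + (y - x) * qterm q (z + INR j * k)
      - (z - x) * qterm q (y + INR j * k)).
    pose proof (qterm_convex q (x + INR j * k) (y + INR j * k) (z + INR j * k)
      Hq (shift_pos k x j Hk Hx) ltac:(lra) ltac:(lra)) as H.
    replace (z + INR j * k - (y + INR j * k)) with (z - y) in H by ring.
    replace (y + INR j * k - (x + INR j * k)) with (y - x) in H by ring.
    replace (z + INR j * k - (x + INR j * k)) with (z - x) in H by ring.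
    exact H.
Qed.

Lemma qk_digamma_eq_series (q k x : R) : 0 < q < 1 -> 0 < k -> 0 < x ->
  qk_digamma q k x = qk_digamma_series q k x.
Proof.
  intros Hq Hk Hx. apply is_derive_unique.
  apply (is_derive_concave_subgradient (fun x => ln (qk_Gamma q k x))).
  - now apply subgradient_ln_qk_Gamma.
  - now apply concave_qk_digamma_series.
  - exact Hx.
Qed.

(** * Monotonicity of the ratio *)

Theorem theorem2p4 (q k a b c d alpha beta : R)
  (hq : 0 < q < 1) (hk : 0 < k)
  (ha : 0 < a) (hb : 0 < b) (hc : 0 < c) (hd : 0 < d)
  (halpha : 0 < alpha) (hbeta : 0 < beta)
  (hle : beta * d <= alpha * b)
  (harg : forall t : R, 0 <= t -> a + b * t <= c + d * t)
  (hpsi_ab : forall t : R, 0 <= t -> 0 < qk_digamma q k (a + b * t))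
  (hpsi_cd : forall t : R, 0 <= t -> 0 < qk_digamma q k (c + d * t)) :
  let G := fun t : R =>
    Rpower (qk_digamma q k (a + b * t)) alpha
    / Rpower (qk_digamma q k (c + d * t)) beta in
  (forall s t : R, 0 <= s -> s <= t -> G s <= G t) /\
  (forall t : R, 0 <= t <= 1 ->
    Rpower (qk_digamma q k a) alpha / Rpower (qk_digamma q k c) beta
    <= Rpower (qk_digamma q k (a + b * t)) alpha
       / Rpower (qk_digamma q k (c + d * t)) beta
    <= Rpower (qk_digamma q k (a + b)) alpha
       / Rpower (qk_digamma q k (c + d)) beta).
Proof.
  intros G.
  assert (Hmono : forall s t : R, 0 <= s -> s <= t -> G s <= G t).
  { intros s t Hs [Hst | <-]; [|lra].
    unfold G, Rpower, Rdiv. rewrite <- !exp_Ropp, <- !exp_plus.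
    assert (Hpos : forall m n r, 0 < m -> 0 < n -> 0 <= r -> 0 < m + n * r)
      by (intros; nra).
    pose proof (Hpos a b s ha hb Hs) as HAs.
    pose proof (Hpos a b t ha hb ltac:(lra)) as HAt.
    pose proof (Hpos c d s hc hd Hs) as HCs.
    pose proof (Hpos c d t hc hd ltac:(lra)) as HCt.
    pose proof (hpsi_ab s Hs) as PAs. pose proof (hpsi_ab t ltac:(lra)) as PAt.
    pose proof (hpsi_cd s Hs) as PCs. pose proof (hpsi_cd t ltac:(lra)) as PCt.
    rewrite qk_digamma_eq_series in PAs, PAt, PCs, PCt by assumption.
    rewrite !qk_digamma_eq_series by assumption.
    pose proof (subgradient_on_increasing _ _ _ (c + d * s) (c + d * t)
      (subgradient_ln_qk_Gamma q k hq hk) HCs HCt ltac:(nra)) as Hinc.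
    apply ln_le in Hinc; [|exact PCs].
    pose proof (concave_on_chords _ _ (a + b * s) (a + b * t)
      (c + d * s) (c + d * t)
      (concave_on_ln _ _ (concave_qk_digamma_series q k hq hk))
      (conj HAs PAs) (conj HAt PAt) (conj HCs PCs) (conj HCt PCt)
      ltac:(nra) ltac:(nra) (harg s Hs) (harg t ltac:(lra))) as Hch.
    cbv beta in Hch.
    set (As := ln (qk_digamma_series q k (a + b * s))) in *.
    set (At := ln (qk_digamma_series q k (a + b * t))) in *.
    set (Cs := ln (qk_digamma_series q k (c + d * s))) in *.
    set (Ct := ln (qk_digamma_series q k (c + d * t))) in *.
    (* The swept intervals have lengths [b * (t - s)] and [d * (t - s)]. *)
    assert (Hb : b * (Ct - Cs) <= d * (At - As)).
    { apply Rmult_le_reg_l with (t - s); [lra|].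
      replace (a + b * t - (a + b * s)) with (b * (t - s)) in Hch by ring.
      replace (c + d * t - (c + d * s)) with (d * (t - s)) in Hch by ring.
      lra. }
    (* Chain [beta * d <= alpha * b] with [Hb]; this uses [Cs <= Ct]. *)
    assert (Hfin : beta * (Ct - Cs) <= alpha * (At - As)).
    { apply Rmult_le_reg_l with d; [exact hd|].
      apply Rmult_le_compat_l with (r := alpha) in Hb; [|lra].
      apply Rmult_le_compat_r with (r := Ct - Cs) in hle; lra. }
    destruct (Rle_lt_or_eq_dec
      (alpha * As + - (beta * Cs)) (alpha * At + - (beta * Ct)) ltac:(lra))
      as [Hlt | ->]; [|lra].
    apply Rlt_le, exp_increasing, Hlt. }
  split; [exact Hmono|].
  intros t Ht. split.
  - pose proof (Hmono 0 t ltac:(lra) ltac:(lra)) as H. unfold G in H.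
    now rewrite !Rmult_0_r, !Rplus_0_r in H.
  - pose proof (Hmono t 1 ltac:(lra) ltac:(lra)) as H. unfold G in H.
    now rewrite !Rmult_1_r in H.
Qed.
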